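(* Let $m,n$ be positive integers and let $A\in H_m$ and $B\in H_n$. Then $U_{A\otimes B}=U_A\otimes U_B$ if and only if one of the following conditions is fulfilled: (a) $A$ has one eigenvalue $a\neq 0$ and $B$ has one or two eigenvalues, given by $$b_{1,2}=\frac{a(1-a)\pm\sqrt{a^2(1-a)^2-4a}}{2a}$$ (that is, every eigenvalue of $B$ belongs to $\{b_1,b_2\}$); (b) $B$ has one eigenvalue $b\neq 0$ and $A$ has one or two eigenvalues, given by $$a_{1,2}=\frac{b(1-b)\pm\sqrt{b^2(1-b)^2-4b}}{2b}$$ (that is, every eigenvalue of $A$ belongs to $\{a_1,a_2\}$).
   Context: $M_n$ denotes the algebra of $n\times n$ complex matrices, $H_n\subset M_n$ the set of Hermitian matrices, $I_n$ the $n\times n$ identity matrix, and $\otimes$ the Kronecker product. For a Hermitian matrix $X\in H_k$ (any $k$), the Cayley transform of $X$ is the unitary matrix $U_X=(X-iI_k)(X+iI_k)^{-1}$. Numbers of eigenvalues refer to distinct eigenvalues (multiplicities are not counted). The eigenvalues of Hermitian matrices are real, so conditions (a) and (b) can hold only when the quantity under the corresponding square root is nonnegative. *)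

(* Defs.v *)
From HB Require Import structures.
From mathcomp Require Import all_boot all_order all_algebra.

Set Implicit Arguments.
Unset Strict Implicit.
Unset Printing Implicit Defensive.

Import Order.TTheory GRing.Theory Num.Theory.
Local Open Scope ring_scope.

Definition cayley (C : numClosedFieldType) (k : nat) (X : 'M[C]_k) : 'M[C]_k :=
  (X - 'i%:M) *m invmx (X + 'i%:M).

(* Eigenvalues are counted without multiplicity. *)
Definition one_eigenvalue (F : fieldType) (k : nat) (X : 'M[F]_k) (a : F) : Prop :=
  forall x : F, eigenvalue X x <-> x = a.

(* [sqrtC] is the complex square root, so no sign condition on the radicand is
   built in; for a Hermitian matrix to have one of the values below (with [a]
   real) as an eigenvalue, the radicand must be nonnegative, and [sqrtC] is then
   the usual real square root. *)
Definition discr_sqrt (C : numClosedFieldType) (a : C) : C :=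
  sqrtC (a ^+ 2 * (1 - a) ^+ 2 - 4 * a).

Definition root_plus (C : numClosedFieldType) (a : C) : C :=
  (a * (1 - a) + discr_sqrt a) / (2 * a).

Definition root_minus (C : numClosedFieldType) (a : C) : C :=
  (a * (1 - a) - discr_sqrt a) / (2 * a).

(* Main.v *)
Require Import Defs.
From mathcomp Require Import all_boot all_order all_algebra.
From mathcomp Require Import reals complex mxtens.
From mathcomp Require Import ring.

(** Unitarily diagonalizing [A] and [B] diagonalizes [A *t B] and all the Cayley
    transforms, so the identity holds iff it holds for scalars [a], [b] running
    over the spectra of [A] and [B]. There, clearing denominators turns it into
    [a b (a + b - 1) + 1 = 0]. For fixed [a] this is a quadratic equation in [b]
    whose roots are those of (a). If [a != a'] both satisfy it with [b], then
    [b = 1 - a - a'], so [A] and [B] cannot both have two eigenvalues. *)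

Set Implicit Arguments.
Unset Strict Implicit.
Unset Printing Implicit Defensive.

Import Order.TTheory GRing.Theory Num.Theory.
Local Open Scope ring_scope.

Section ScalarEquation.
Variable C : numClosedFieldType.
Implicit Types a b : C.

Definition cayley_scalar a : C := (a - 'i) / (a + 'i).

Definition eigen_relation a b : Prop := a * b * (a + b - 1) + 1 = 0.

Lemma eigen_relationC a b : eigen_relation a b -> eigen_relation b a.
Proof. by rewrite /eigen_relation [b * a]mulrC [b + a]addrC. Qed.

Lemma eigen_relation_neq0 a b : eigen_relation a b -> a != 0.
Proof.
rewrite /eigen_relation; apply: contra_eq_neq => ->.
by rewrite !mul0r add0r oner_neq0.
Qed.

Lemma real_addi_neq0 a : a \is Num.real -> a + 'i != 0.
Proof.
move=> ra; apply/negP => /eqP /(congr1 (fun z => 'Im z)).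
by rewrite raddfD /= (Creal_ImP _ ra) Im_i raddf0 add0r => /eqP; rewrite oner_eq0.
Qed.

Lemma cayley_scalarM a b : a \is Num.real -> b \is Num.real ->
  cayley_scalar (a * b) = cayley_scalar a * cayley_scalar b <->
  eigen_relation a b.
Proof.
move=> ra rb.
have na := real_addi_neq0 ra; have nb := real_addi_neq0 rb.
have nab := real_addi_neq0 (rpredM ra rb).
(* With [- 'i ^+ 2] left unsimplified, this is an identity of rational functions in which ['i] is a
   free symbol, so [field] proves it; [sqrCi] then turns that term into [+ 1]. *)
have key : cayley_scalar (a * b) - cayley_scalar a * cayley_scalar b =
    2 * 'i * (a * b * (a + b - 1) - 'i ^+ 2) / ((a * b + 'i) * ((a + 'i) * (b + 'i))).
  by rewrite /cayley_scalar; field; rewrite na nb nab.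
rewrite sqrCi opprK in key.
split=> [/eqP|E]; last by apply/eqP; rewrite -subr_eq0 key E mulr0 mul0r.
rewrite -subr_eq0 key !mulf_eq0 invr_eq0 !mulf_eq0 (negbTE na) (negbTE nb).
rewrite (negbTE nab) pnatr_eq0 (negbTE (neq0Ci C)) !orbF /=.
by move/eqP.
Qed.

Lemma eigen_relation_roots a b : a != 0 ->
  eigen_relation a b <-> b = root_plus a \/ b = root_minus a.
Proof.
move=> a0; rewrite /eigen_relation /root_plus /root_minus /discr_sqrt.
set D := _ - 4 * a; have sD := sqrtCK D; set s := sqrtC D in sD *.
have a2 : 2 * a != 0 by rewrite mulf_neq0 // pnatr_eq0.
(* Completing the square: the left side is [(2ab - a(1 - a))^2 - D], a difference of squares because
   [s ^+ 2 = D]. *)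
have key : 4 * a * (a * b * (a + b - 1) + 1) =
    (b * (2 * a) - (a * (1 - a) + s)) * (b * (2 * a) - (a * (1 - a) - s)).
  by rewrite mulrC; transitivity ((b * (2 * a) - a * (1 - a)) ^+ 2 - s ^+ 2);
    [rewrite sD /D|]; ring.
have a4 : 4 * a != 0 by rewrite mulf_neq0 // pnatr_eq0.
split=> [E|[] bE].
- move: key; rewrite E mulr0 => /esym/eqP; rewrite mulf_eq0 !subr_eq0.
  by case/orP=> /eqP E'; [left|right]; rewrite -E' mulfK.
- by apply: (mulfI a4); rewrite key bE divfK // subrr mul0r mulr0.
- by apply: (mulfI a4); rewrite key bE divfK // subrr !mulr0.
Qed.

Lemma eigen_relation_constant (I J : finType) (d : I -> C) (e : J -> C)
    (i0 : I) (j0 : J) :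
  (forall i j, eigen_relation (d i) (e j)) ->
  (forall i, d i = d i0) \/ (forall j, e j = e j0).
Proof.
move=> rel; have [/forallP h|] := boolP [forall i, d i == d i0].
  by left=> i; apply/eqP.
rewrite negb_forall => /existsP[i1 ne]; right.
(* The right-hand side does not depend on [j], so [e] is constant. *)
suff sum j : e j = 1 - d i0 - d i1 by move=> j; rewrite !sum.
have nz := eigen_relation_neq0 (eigen_relationC (rel i0 j)).
(* This product is the relation at [(i1, j)] minus the relation at [(i0, j)]; its first two factors
   are nonzero. *)
have /eqP : e j * (d i1 - d i0) * (e j - (1 - d i0 - d i1)) = 0.
  by rewrite -[RHS](subrr 0) -{1}(rel i1 j) -(rel i0 j); ring.
by rewrite !mulf_eq0 (negbTE nz) !subr_eq0 (negbTE ne) => /eqP.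
Qed.

End ScalarEquation.

Section Diagonalization.
Variable C : numClosedFieldType.

Lemma tens_diag_mx m n (d : 'rV[C]_m) (e : 'rV[C]_n) :
  diag_mx d *t diag_mx e =
  diag_mx (\row_k (d 0 (mxtens_unindex k).1 * e 0 (mxtens_unindex k).2)).
Proof.
apply/matrixP=> k l; case: (mxtens_indexP k) => i j.
case: (mxtens_indexP l) => i' j'; rewrite tensmxE !mxE !mxtens_indexK /=.
rewrite (can_eq (@mxtens_indexK m n)) xpair_eqE.
by case: eqVneq => [_|_]; case: eqVneq => [_|_]; rewrite /= ?mulr0n ?mulr0 ?mul0r.
Qed.

Lemma tens_scalar1 m n : 1%:M *t 1%:M = 1%:M :> 'M[C]_(m * n).
Proof.
rewrite -!diag_const_mx tens_diag_mx; congr diag_mx.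
by apply/rowP=> k; rewrite !mxE mulr1.
Qed.

(** Both sides use the same basis, so the diagonals agree entry by entry and not merely up to a
    permutation. *)
Lemma conj_diag_mx_inj k (P Q : 'M[C]_k) (d e : 'rV[C]_k) : Q *m P = 1%:M ->
  Q *m diag_mx d *m P = Q *m diag_mx e *m P -> d = e.
Proof.
move=> QP; have PQ := mulmx1C QP.
move/(congr1 (fun X => P *m X *m Q)).
rewrite -!mulmxA PQ !mulmx1 !mulmxA PQ !mul1mx => /matrixP E.
by apply/rowP=> i; have := E i i; rewrite !mxE eqxx.
Qed.

Lemma conj_scalar_mx k (P Q : 'M[C]_k) (c : C) : Q *m P = 1%:M ->
  c%:M = Q *m diag_mx (const_mx c) *m P.
Proof. by move=> QP; rewrite diag_const_mx mul_mx_scalar -scalemxAl QP scalemx1. Qed.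

Lemma cayley_conj_diag k (P Q : 'M[C]_k) (d : 'rV[C]_k) : Q *m P = 1%:M ->
  (forall i, d 0 i \is Num.real) ->
  cayley (Q *m diag_mx d *m P) =
  Q *m diag_mx (map_mx (@cayley_scalar C) d) *m P.
Proof.
move=> QP rd; have PQ := mulmx1C QP; have [uQ uP] := mulmx1_unit QP.
have addE c : Q *m diag_mx d *m P + c%:M = Q *m diag_mx (d + const_mx c) *m P.
  by rewrite (conj_scalar_mx c QP) -mulmxDl -mulmxDr -raddfD.
have unitD : diag_mx (d + const_mx 'i) \in unitmx.
  rewrite unitmxE det_diag unitfE; apply/prodf_neq0 => i _.
  by rewrite !mxE real_addi_neq0.
(* Multiplying by the invertible [X + 'i%:M] on the right removes [invmx], leaving a product of
   diagonal matrices to compare. *)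
rewrite /cayley -raddfN !addE; apply: (canLR (mulmxK _)).
  by rewrite !unitmx_mul uQ unitD.
rewrite -!mulmxA (mulmxA P Q) PQ mul1mx (mulmxA (diag_mx _) (diag_mx _)).
congr (_ *m (_ *m _)); rewrite mulmx_diag; congr diag_mx.
by apply/rowP=> i; rewrite !mxE /cayley_scalar divfK // real_addi_neq0.
Qed.

Lemma eigenvalue_conj_diag k (P Q : 'M[C]_k) (d : 'rV[C]_k) (x : C) :
  Q *m P = 1%:M ->
  eigenvalue (Q *m diag_mx d *m P) x <-> exists i, x = d 0 i.
Proof.
move=> QP; have PQ := mulmx1C QP.
split=> [/eigenvalueP[v vX v0]|[i ->]].
  (* Eigenvectors here are rows. In the new basis [v] becomes [v *m Q], and any nonzero coordinate
     [i] of it forces [x = d 0 i]. *)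
  have wD : v *m Q *m diag_mx d = x *: (v *m Q).
    by rewrite scalemxAl -vX -!mulmxA PQ mulmx1.
  have /rV0Pn[i wi] : v *m Q != 0.
    apply: contra_neq v0 => vQ.
    by rewrite -[v]mulmx1 -QP mulmxA vQ mul0mx.
  exists i; apply: (mulIf wi).
  by move/rowP/(_ i): wD; rewrite mul_mx_diag !mxE mulrC => ->.
(* The witness is the [i]-th row of [P]. *)
apply/eigenvalueP; exists (delta_mx 0 i *m P).
  rewrite !mulmxA -(mulmxA _ P Q) PQ mulmx1 -(rowE i (diag_mx d)) row_diag_mx.
  by rewrite -scalemxAl.
apply/eqP=> /(congr1 (mulmx^~ Q)); rewrite -mulmxA PQ mulmx1 mul0mx.
by move/rowP/(_ i)/eqP; rewrite !mxE !eqxx oner_eq0.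
Qed.

(** Positivity of [k] provides an index at which [a] is attained; in dimension 0 the right side
    holds vacuously although there is no eigenvalue. *)
Lemma one_eigenvalue_conj_diag k (P Q : 'M[C]_k) (d : 'rV[C]_k) (a : C) :
  (0 < k)%N -> Q *m P = 1%:M ->
  one_eigenvalue (Q *m diag_mx d *m P) a <-> forall i, d 0 i = a.
Proof.
move=> k0 QP; split=> [one i|h x].
  by apply/one/(eigenvalue_conj_diag _ _ QP); exists i.
rewrite (eigenvalue_conj_diag _ _ QP); split=> [[i ->]//|->].
by exists (Ordinal k0).
Qed.

(** The pair [P *t P'], [Q *t Q'] diagonalizes both sides at once, and the diagonal entry indexed by
    [(i, j)] is the scalar identity for [d 0 i] and [e 0 j]. *)
Lemma cayley_tens_conj_diag m n (P Q : 'M[C]_m) (P' Q' : 'M[C]_n)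
    (d : 'rV[C]_m) (e : 'rV[C]_n) :
  Q *m P = 1%:M -> Q' *m P' = 1%:M ->
  (forall i, d 0 i \is Num.real) -> (forall j, e 0 j \is Num.real) ->
  let A := Q *m diag_mx d *m P in let B := Q' *m diag_mx e *m P' in
  cayley (A *t B) = cayley A *t cayley B <->
  forall i j, eigen_relation (d 0 i) (e 0 j).
Proof.
move=> QP QP' rd re A B.
have QPt : (Q *t Q') *m (P *t P') = 1%:M by rewrite tensmx_mul QP QP' tens_scalar1.
rewrite /A /B !cayley_conj_diag // -!tensmx_mul !tens_diag_mx cayley_conj_diag //;
  last by move=> k; rewrite mxE rpredM.
split=> [/(conj_diag_mx_inj QPt)/rowP E i j|E].
  apply/cayley_scalarM => //.
  by have := E (mxtens_index (i, j)); rewrite !mxE mxtens_indexK.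
congr (_ *m diag_mx _ *m _); apply/rowP=> k; rewrite !mxE.
exact/cayley_scalarM.
Qed.

(** The spectral theorem, with unitarity weakened to [Q *m P = 1%:M], a condition that passes
    directly to tensor products. *)
Lemma hermsymmx_diagonalization k (A : 'M[C]_k) : A \is hermsymmx ->
  exists P Q (d : 'rV[C]_k), [/\ Q *m P = 1%:M,
    forall i, d 0 i \is Num.real & A = Q *m diag_mx d *m P].
Proof.
move=> hA; exists (spectralmx A), (invmx (spectralmx A)), (spectral_diag A).
split; first by rewrite mulVmx // spectral_unit.
  by move=> i; apply/mxOverP/hermitian_spectral_diag_real.
exact/orthomx_spectralP/hermitian_normalmx.
Qed.

End Diagonalization.

Local Open Scope complex_scope.

Theorem theorem2p5 (R : realType) (m n : nat) (hm : (0 < m)%N) (hn : (0 < n)%N)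
    (A : 'M[R[i]]_m) (B : 'M[R[i]]_n)
    (hA : A \is hermsymmx) (hB : B \is hermsymmx) :
  cayley (A *t B) = cayley A *t cayley B <->
    (exists a : R[i], [/\ a != 0, one_eigenvalue A a &
       forall b : R[i], eigenvalue B b -> b = root_plus a \/ b = root_minus a])
    \/
    (exists b : R[i], [/\ b != 0, one_eigenvalue B b &
       forall a : R[i], eigenvalue A a -> a = root_plus b \/ a = root_minus b]).
Proof.
have [P [Q [d [QP rd ->]]]] := hermsymmx_diagonalization hA.
have [P' [Q' [e [QP' re ->]]]] := hermsymmx_diagonalization hB.
rewrite cayley_tens_conj_diag //; split=> [rel|].
  have nzd i : d 0 i != 0 := eigen_relation_neq0 (rel i (Ordinal hn)).
  have nze j : e 0 j != 0 :=
    eigen_relation_neq0 (eigen_relationC (rel (Ordinal hm) j)).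
  (* The constant spectrum decides between (a) and (b); the other matrix's eigenvalues then solve
     the quadratic with that constant as parameter. *)
  have [cst|cst] := eigen_relation_constant (Ordinal hm) (Ordinal hn) rel.
    left; exists (d 0 (Ordinal hm)); split=> //; first exact/one_eigenvalue_conj_diag.
    by move=> b /(eigenvalue_conj_diag _ _ QP')[j ->]; apply/eigen_relation_roots.
  right; exists (e 0 (Ordinal hn)); split=> //; first exact/one_eigenvalue_conj_diag.
  move=> a /(eigenvalue_conj_diag _ _ QP)[i ->].
  by apply/eigen_relation_roots => //; apply/eigen_relationC.
(* Conversely, one diagonal is constant and every entry of the other is a root of the associated
   quadratic, which gives the relation for all pairs. *)
case=> [[a [a0 /(one_eigenvalue_conj_diag _ _ hm QP) da hroots]]|
        [b [b0 /(one_eigenvalue_conj_diag _ _ hn QP') eb hroots]]] i j.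
  rewrite da; apply/eigen_relation_roots => //; apply: hroots.
  by apply/(eigenvalue_conj_diag _ _ QP'); exists j.
rewrite eb; apply/eigen_relationC/eigen_relation_roots => //; apply: hroots.
by apply/(eigenvalue_conj_diag _ _ QP); exists i.
Qed.
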